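(* Let $n \geq 2$. If $E \subseteq \mathbb{R}^n$ is a union of a nonempty family of line segments and $\mathbf{L}(E)$ is its lineal extension, then $$\dim_{\mathrm H} \mathbf{L}(E) \leq \dim_{\mathrm H} E + \dim_{\mathrm P} E - 1 \quad \text{and} \quad \dim_{\mathrm P} \mathbf{L}(E) \leq 2 \dim_{\mathrm P} E - 1.$$
   Context: $\dim_{\mathrm H}$ and $\dim_{\mathrm P}$ denote Hausdorff and packing dimension, respectively. Sets are arbitrary (no measurability is assumed). $\mathcal{A}(n,1)$ is the set of all (affine) lines in $\mathbb{R}^n$. Line segments are nondegenerate. If $E \subseteq \mathbb{R}^n$ is a union of line segments, its lineal extension is $$\mathbf{L}(E) := \bigcup \{ \ell \in \mathcal{A}(n,1) : E \cap \ell \text{ contains a line segment} \}.$$ *)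

(* Defs.v *)
From HB Require Import structures.
From mathcomp Require Import all_boot all_order all_algebra.
From mathcomp Require Import all_classical all_reals all_analysis.

Set Implicit Arguments.
Unset Strict Implicit.
Unset Printing Implicit Defensive.

Import Order.TTheory GRing.Theory Num.Theory.
Import numFieldNormedType.Exports.

Local Open Scope classical_set_scope.
Local Open Scope ring_scope.

(* The norm that MathComp-Analysis puts on ['rV[R]_n] is the sup norm; metric
   notions below use the Euclidean norm instead. *)
Definition enorm (R : realType) (n : nat) (x : 'rV[R]_n) : R :=
  Num.sqrt (\sum_(i < n) x ord0 i ^+ 2).

Definition ecball (R : realType) (n : nat) (x : 'rV[R]_n) (r : R) :
    set 'rV[R]_n :=
  [set y | enorm (y - x) <= r].

(* [-oo] on the empty set. *)
Definition diam (R : realType) (n : nat) (A : set 'rV[R]_n) : \bar R :=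
  ereal_sup [set (enorm (x - y))%:E | x in A & y in A].

(* Empty pieces contribute 0, also for [s = 0]; nonempty pieces of diameter 0
   contribute [0 `^ s], which is 1 for [s = 0] and 0 for [0 < s]. *)
Definition hausdorff_delta (R : realType) (n : nat) (s delta : R)
    (E : set 'rV[R]_n) : \bar R :=
  ereal_inf [set (\sum_(0 <= i <oo | U i != set0) (poweR (diam (U i)) s))%E
            | U in [set U : nat -> set 'rV[R]_n |
                 E `<=` \bigcup_i U i /\
                 forall i, (diam (U i) <= delta%:E)%E]].

(* The limit as [delta] tends to 0, written as a supremum by monotonicity. *)
Definition hausdorff_measure (R : realType) (n : nat) (s : R)
    (E : set 'rV[R]_n) : \bar R :=
  ereal_sup [set hausdorff_delta s delta E | delta in [set d : R | 0 < d]].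

Definition hausdorff_dim (R : realType) (n : nat) (E : set 'rV[R]_n) : \bar R :=
  ereal_inf [set s%:E | s in [set s : R |
    0 <= s /\ hausdorff_measure s E = 0%E]].

(* A packing is given by the set of its (center, radius) pairs. *)
Definition is_packing (R : realType) (n : nat) (delta : R) (E : set 'rV[R]_n)
    (P : set ('rV[R]_n * R)) : Prop :=
  [/\ countable P,
      forall p, P p -> [/\ E p.1, 0 < p.2 & p.2 <= delta] &
      trivIset P (fun p => ecball p.1 p.2)].

Definition packing_delta (R : realType) (n : nat) (s delta : R)
    (E : set 'rV[R]_n) : \bar R :=
  ereal_sup [set (\esum_(p in P) ((2 * p.2) `^ s)%:E)%E
            | P in is_packing delta E].

(* The limit as [delta] tends to 0, written as an infimum by monotonicity. *)
Definition packing_premeasure (R : realType) (n : nat) (s : R)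
    (E : set 'rV[R]_n) : \bar R :=
  ereal_inf [set packing_delta s delta E | delta in [set d : R | 0 < d]].

Definition packing_measure (R : realType) (n : nat) (s : R)
    (E : set 'rV[R]_n) : \bar R :=
  ereal_inf [set (\sum_(0 <= i <oo) packing_premeasure s (A i))%E
            | A in [set A : nat -> set 'rV[R]_n | E `<=` \bigcup_i A i]].

Definition packing_dim (R : realType) (n : nat) (E : set 'rV[R]_n) : \bar R :=
  ereal_inf [set s%:E | s in [set s : R |
    0 <= s /\ packing_measure s E = 0%E]].

(* Segments are closed; any nondegenerate segment, with or without its
   endpoints, is a union of closed ones and contains one, so unions of segments
   and lineal extensions do not depend on this choice. *)
Definition is_segment (R : realType) (n : nat) (S : set 'rV[R]_n) : Prop :=
  exists a b : 'rV[R]_n,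
    a <> b /\ S = [set (1 - t) *: a + t *: b | t in `[0, 1]].

Definition is_line (R : realType) (n : nat) (l : set 'rV[R]_n) : Prop :=
  exists a v : 'rV[R]_n, v <> 0 /\ l = [set a + t *: v | t in [set: R]].

Definition union_of_segments (R : realType) (n : nat) (E : set 'rV[R]_n) :
    Prop :=
  exists F : set (set 'rV[R]_n),
    [/\ F !=set0, F `<=` @is_segment R n & E = \bigcup_(S in F) S].

Definition lineal_extension (R : realType) (n : nat) (E : set 'rV[R]_n) :
    set 'rV[R]_n :=
  \bigcup_(l in [set l | is_line l /\
                   exists S, is_segment S /\ S `<=` E `&` l]) l.

(* Main.v *)
(** Call a set [s]-covered when it has finite lists of balls of radius [2^-k],
one list for each [k], with [sum_k #balls * 2^-(k s)] finite, such that each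
point of the set lies in a ball of the [k]-th list for infinitely many [k]
(Hausdorff version) or for all large [k] (packing version). Up to an arbitrarily
small change of [s], this characterizes dimension at most [s] in both cases.

Counting the balls that meet a hyperplane [x_i = a] and integrating in [a]
shows that for almost every [a] the slice of an [s]-covered set is
[(s - 1)]-covered. A line meeting [E] in a segment meets, for some coordinate
[i], two such slices with [a] in a fixed countable set of good values. Hence
[L(E)] is a countable union of images of [slice * slice * [-M, M]] under
[(x, y, t) |-> x + t (y - x)]; multiplying covers scale by scale (using
that the second factor is covered at all large scales) bounds the exponent of
such an image by [(s - 1) + (t - 1) + 1]. *)

Require Import Defs.
From mathcomp Require Import all_boot all_order all_algebra.
From mathcomp Require Import all_classical all_reals all_analysis.
From mathcomp Require Import measurable_realfun.
From mathcomp Require Import ring lra zify.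

Set Implicit Arguments.
Unset Strict Implicit.
Unset Printing Implicit Defensive.

Import Order.TTheory GRing.Theory Num.Theory.
Import numFieldNormedType.Exports.

Local Open Scope classical_set_scope.
Local Open Scope ring_scope.

(** * The Euclidean norm *)

Section Euclid.
Context {R : realType} {n : nat}.
Implicit Types x y z : 'rV[R]_n.

Let sqsum x : R := \sum_(i < n) x ord0 i ^+ 2.

Let sqsum_ge0 x : 0 <= sqsum x.
Proof. by apply: sumr_ge0 => i _; exact: sqr_ge0. Qed.

Lemma enorm_ge0 x : 0 <= enorm x.
Proof. exact: sqrtr_ge0. Qed.

Let enorm_sqr x : enorm x ^+ 2 = sqsum x.
Proof. by rewrite /enorm sqr_sqrtr ?sqsum_ge0. Qed.

Lemma enorm0 : enorm (0 : 'rV[R]_n) = 0.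
Proof. by rewrite /enorm big1 ?sqrtr0// => i _; rewrite mxE expr0n. Qed.

Lemma enormZ (a : R) x : enorm (a *: x) = `|a| * enorm x.
Proof.
rewrite /enorm (eq_bigr (fun i => a ^+ 2 * x ord0 i ^+ 2)); last first.
  by move=> i _; rewrite mxE exprMn.
by rewrite -mulr_sumr sqrtrM ?sqr_ge0// sqrtr_sqr.
Qed.

Lemma enormN x : enorm (- x) = enorm x.
Proof. by rewrite -scaleN1r enormZ normrN1 mul1r. Qed.

Lemma enormC x y : enorm (x - y) = enorm (y - x).
Proof. by rewrite -enormN opprB. Qed.

Lemma coord_le_enorm x i : `|x ord0 i| <= enorm x.
Proof.
rewrite -sqrtr_sqr ler_wsqrtr// (bigD1 i)//= lerDl.
by apply: sumr_ge0 => j _; exact: sqr_ge0.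
Qed.

Lemma enorm_eq0 x : enorm x = 0 -> x = 0.
Proof.
move=> x0; apply/rowP => i; apply/eqP; rewrite mxE -normr_le0 -x0.
exact: coord_le_enorm.
Qed.

(** Cauchy-Schwarz: with a = |x| and b = |y| nonzero, expand |b x - a y|^2 >= 0 and divide by
    2ab. *)
Let inner_le x y : \sum_(i < n) x ord0 i * y ord0 i <= enorm x * enorm y.
Proof.
have [x0|x0] := eqVneq (enorm x) 0.
  by rewrite x0 (enorm_eq0 x0) mul0r big1// => i _; rewrite mxE mul0r.
have [y0|y0] := eqVneq (enorm y) 0.
  by rewrite y0 (enorm_eq0 y0) mulr0 big1// => i _; rewrite mxE mulr0.
set a := enorm x; set b := enorm y.
have a0 : 0 < a by rewrite lt_def x0 enorm_ge0.
have b0 : 0 < b by rewrite lt_def y0 enorm_ge0.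
have : 0 <= sqsum (b *: x - a *: y) by [].
have -> : sqsum (b *: x - a *: y) =
    b ^+ 2 * sqsum x - 2 * a * b * \sum_(i < n) x ord0 i * y ord0 i
    + a ^+ 2 * sqsum y.
  rewrite /sqsum !mulr_sumr -sumrB -big_split/=; apply: eq_bigr => i _.
  by rewrite !mxE; ring.
rewrite -!enorm_sqr -/a -/b; set s := \sum_(i < n) _ => h.
have ab : 0 < 2 * a * b by rewrite !mulr_gt0.
rewrite -(ler_pM2l ab); move: h; clear; nra.
Qed.

Lemma enormD x y : enorm (x + y) <= enorm x + enorm y.
Proof.
rewrite -(@ler_pXn2r _ 2)// ?nnegrE ?addr_ge0 ?enorm_ge0// enorm_sqr sqrrD.
rewrite !enorm_sqr.
have -> : sqsum (x + y) =
    sqsum x + (\sum_(i < n) x ord0 i * y ord0 i) *+ 2 + sqsum y.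
  rewrite /sqsum -sumrMnl -!big_split/=; apply: eq_bigr => i _.
  by rewrite !mxE sqrrD.
by rewrite lerD2r lerD2l lerMn2r/= inner_le.
Qed.

Lemma enorm_triangle x y z : enorm (x - z) <= enorm (x - y) + enorm (y - z).
Proof. by rewrite (_ : x - z = (x - y) + (y - z)) ?enormD// addrA subrK. Qed.

End Euclid.

(** * Series and dyadic scales *)

Lemma ler_sum_nat_sub (R : realDomainType) (u : nat -> R) (m p : nat) :
  (forall k, 0 <= u k) -> (m <= p)%N ->
  \sum_(0 <= k < m) u k <= \sum_(0 <= k < p) u k.
Proof.
by move=> u0 mp; rewrite (big_cat_nat (leq0n m) mp)//= lerDl sumr_ge0.
Qed.

(** Some partial sum comes within [e] of the supremum, so no later block of terms can exceed [e]. *)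
Lemma bounded_series_tail (R : realType) (u : nat -> R) (C : R) :
  (forall k, 0 <= u k) -> (forall N, \sum_(0 <= k < N) u k <= C) ->
  forall e, 0 < e ->
  exists K, forall J N, (K <= J)%N -> \sum_(J <= k < N) u k <= e.
Proof.
move=> u0 uC e e0.
pose S := [set \sum_(0 <= k < N) u k | N in [set: nat]].
have supS : has_sup S.
  split; first by exists (\sum_(0 <= k < 0) u k); exists 0%N.
  by exists C => _ [N _ <-].
have [_ [K _ <-] SK] := sup_adherent e0 supS.
exists K => J N KJ; have [NJ|/ltnW JN] := leqP N J.
  by rewrite big_geq// ltW.
have : \sum_(0 <= k < N) u k <= sup S by apply: sup_upper_bound => //; exists N.
have := ler_sum_nat_sub u0 KJ.
by rewrite (big_cat_nat (leq0n J) JN)/=; move: SK; clear; lra.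
Qed.

(* [2 ^ - s], so that a ball of radius [2 ^ - k] has [s]-weight
   [scale s ^+ k]. *)
Definition scale {R : realType} (s : R) : R := 2 `^ (- s).

Section Scale.
Context {R : realType}.
Implicit Types s t : R.

Lemma scale_gt0 s : 0 < scale s.
Proof. by rewrite powR_gt0. Qed.

Lemma scaleX_ge0 s k : 0 <= scale s ^+ k.
Proof. by rewrite exprn_ge0// ltW// scale_gt0. Qed.

Lemma scaleD s t : scale (s + t) = scale s * scale t.
Proof. by rewrite /scale opprD powRD// pnatr_eq0/= implybT. Qed.

Lemma scale1 : scale (1 : R) = 2^-1.
Proof. by rewrite /scale powR_inv1. Qed.

Lemma scale0 : scale (0 : R) = 1.
Proof. by rewrite /scale oppr0 powRr0. Qed.

Lemma scale_lt1 s : 0 < s -> scale s < 1.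
Proof.
move=> s0; rewrite /scale powRN invf_lt1 ?powR_gt0//.
have : 1 `^ s < 2 `^ s :> R by apply: gt0_ltr_powR; rewrite ?nnegrE ?ltr1n.
by rewrite powR1.
Qed.

Lemma scale_ge1 s : s <= 0 -> 1 <= scale s.
Proof.
by move=> s0; rewrite -scale0 /scale ler_powR ?ler1n// lerN2.
Qed.

Lemma powR_half s k : (2^-1 ^+ k) `^ s = scale s ^+ k.
Proof.
have -> : 2^-1 ^+ k = 2 `^ (- k%:R) :> R by rewrite exprVn powR_invn.
have -> : scale s ^+ k = (2 `^ (- s)) `^ k%:R.
  by rewrite powR_mulrn// powR_ge0.
rewrite -(powRrM 2 (- k%:R) s) -(powRrM 2 (- s) k%:R).
by congr (2 `^ _); rewrite !mulNr mulrC.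
Qed.

End Scale.

(** * Dyadic covers *)

(** The Boolean lets the Hausdorff and the packing case share one argument. *)
Definition often (b : bool) (P : nat -> Prop) : Prop :=
  if b then exists K, forall k, (K <= k)%N -> P k
  else forall K, exists2 k, (K <= k)%N & P k.

Lemma often_imp b (K : nat) (P Q : nat -> Prop) :
  (forall k, (K <= k)%N -> P k -> Q k) -> often b P -> often b Q.
Proof.
case: b => PQ /=.
  move=> [M PM]; exists (maxn K M) => k; rewrite geq_max => /andP[Kk Mk].
  exact/PQ/PM.
move=> P_ M; have [k] := P_ (maxn K M).
by rewrite geq_max => /andP[Kk Mk] Pk; exists k => //; exact: PQ.
Qed.

Lemma often_and b (P Q : nat -> Prop) :
  often b P -> often true Q -> often b (fun k => P k /\ Q k).
Proof. by move=> bP [K QK]; apply: often_imp bP => k /QK. Qed.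

Lemma often_shift b (P : nat -> Prop) (d : nat) :
  often b P -> often b (fun k => P (k + d)%N).
Proof.
case: b => /=.
  move=> [K PK]; exists K => k Kk; apply: PK.
  exact: leq_trans (leq_addr _ _).
move=> P_ K; have [k Kk Pk] := P_ (K + d)%N; exists (k - d)%N; first by lia.
by rewrite subnK//; lia.
Qed.

Section Cov.
Context {R : realType} {n : nat}.
Implicit Types (E : set 'rV[R]_n) (s t : R) (b : bool).

Definition balls (l : seq 'rV[R]_n) (r : R) : set 'rV[R]_n :=
  [set x | exists2 c, c \in l & enorm (x - c) <= r].

Definition weight (T : Type) s (l : nat -> seq T) k : R :=
  (size (l k))%:R * scale s ^+ k.

(* [b = false] corresponds to Hausdorff and [b = true] to packing dimension. *)
Definition cov b s E : Prop :=
  exists l : nat -> seq 'rV[R]_n,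
    (exists C, forall N, \sum_(0 <= k < N) weight s l k <= C) /\
    forall x, E x -> often b (fun k => balls (l k) (2^-1 ^+ k) x).

Lemma weight_ge0 (T : Type) s (l : nat -> seq T) k : 0 <= weight s l k.
Proof. by rewrite mulr_ge0// scaleX_ge0. Qed.

Lemma balls_sub (l l' : seq 'rV[R]_n) r :
  {subset l <= l'} -> balls l r `<=` balls l' r.
Proof. by move=> ll' x [c cl xc]; exists c => //; exact: ll'. Qed.

Lemma sub_cov b s E E' : E `<=` E' -> cov b s E' -> cov b s E.
Proof.
by move=> EE' [l [Cl El]]; exists l; split=> // x /EE'; exact: El.
Qed.

Lemma cov0 b s : cov b s (set0 : set 'rV[R]_n).
Proof.
exists (fun=> [::]); split=> //; exists 0 => N.
by rewrite big1// => k _; rewrite /weight mul0r.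
Qed.

(** If [s <= 0], every nonempty list weighs at least 1, and a point of [E] makes infinitely many
    lists nonempty, so the weights could not be summable. This supplies the sign condition on
    exponents in the definitions of both dimensions. *)
Lemma cov_nonempty b s E : cov b s E -> E !=set0 -> 0 < s.
Proof.
move=> [l [[C lC] El]] [x Ex]; rewrite ltNge; apply/negP => s0.
have [K KC] := bounded_series_tail (weight_ge0 s l) lC
  (e := 2^-1) ltac:(by rewrite invr_gt0).
have : often false (fun k => balls (l k) (2^-1 ^+ k) x).
  have := El _ Ex; case: b {El} => //= -[M bM] N; exists (maxn M N).
    exact: leq_maxr.
  exact/bM/leq_maxl.
move=> /(_ K)[k Kk [c ck _]].
have := KC K k.+1 (leqnn K); rewrite big_nat_recr//=; apply/negP.
rewrite -ltNge.
apply: (@lt_le_trans _ _ 1); first by rewrite invf_lt1 ?ltr1n.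
rewrite ler_wpDl ?sumr_ge0// => [i _|]; first exact: weight_ge0.
rewrite /weight -[leLHS]mulr1 ler_pM ?ler1n ?exprn_ege1 ?scale_ge1//.
by case: (l k) ck.
Qed.

Lemma sum_half (N : nat) : \sum_(0 <= i < N) (2^-1 ^+ i : R) <= 2.
Proof.
suff -> : \sum_(0 <= i < N) (2^-1 ^+ i : R) = 2 - 2 * 2^-1 ^+ N.
  by rewrite gerBl mulr_ge0// exprn_ge0.
elim: N => [|N ih]; first by rewrite big_geq// expr0 mulr1 subrr.
by rewrite big_nat_recr//= ih exprS; field.
Qed.

(** Merges countably many families; the [i]-th one enters only from scale [i] on, which keeps each
    list finite. *)
Definition diagonal (T : Type) (l : nat -> nat -> seq T) k : seq T :=
  flatten [seq l i k | i <- iota 0 k.+1].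

Lemma mem_diagonal (T : eqType) (l : nat -> nat -> seq T) i k :
  (i <= k)%N -> {subset l i k <= diagonal l k}.
Proof.
move=> ik x xl; apply/flattenP; exists (l i k) => //.
by apply/mapP; exists i => //; rewrite mem_iota.
Qed.

Lemma weight_diagonal (T : Type) s (l : nat -> nat -> seq T) (C : R) :
  0 <= C ->
  (forall i N, \sum_(0 <= k < N) weight s (l i) k <= C * 2^-1 ^+ i) ->
  forall N, \sum_(0 <= k < N) weight s (diagonal l) k <= C * 2.
Proof.
move=> C0 lC N.
apply: (@le_trans _ _ (\sum_(0 <= k < N) \sum_(0 <= i < N) weight s (l i) k)).
  rewrite big_nat [leRHS]big_nat; apply: ler_sum => k /andP[_ kN].
  rewrite /weight size_flatten sumnE big_map big_map natr_sum mulr_suml.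
  have -> : iota 0 k.+1 = index_iota 0 k.+1 by rewrite /index_iota subn0.
  by apply: ler_sum_nat_sub => // i; exact: weight_ge0.
rewrite exchange_big_nat/=.
apply: (@le_trans _ _ (\sum_(0 <= i < N) C * 2^-1 ^+ i)).
  by apply: ler_sum => i _; exact: lC.
by rewrite -mulr_sumr ler_wpM2l// sum_half.
Qed.

(** Dropping finitely many scales does not affect [often]. So the [i]-th family is cut off until its
    tail weighs at most 2^-i, and the truncated families are merged diagonally. *)
Lemma cov_bigcup_nat b s (A : nat -> set 'rV[R]_n) :
  (forall i, cov b s (A i)) -> cov b s (\bigcup_i A i).
Proof.
move=> /choice[l /all_and2[lC lA]].
have /choice[K KP] : forall i, exists K, forall N,
    \sum_(K <= k < N) weight s (l i) k <= 2^-1 ^+ i.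
  move=> i; have [C iC] := lC i.
  have r0 : 0 < 2^-1 ^+ i :> R by rewrite exprn_gt0.
  have [J JP] := bounded_series_tail (weight_ge0 s (l i)) iC r0.
  by exists J => N; exact: JP.
pose l' i k := if (K i <= k)%N then l i k else [::].
exists (diagonal l'); split.
  exists (1 * 2); apply: weight_diagonal => // i N; rewrite mul1r.
  apply: le_trans (KP i N); rewrite (eq_bigr (fun k =>
    if (K i <= k)%N then weight s (l i) k else 0)); last first.
    by move=> k _; rewrite /weight /l'; case: ifP => //; rewrite mul0r.
  rewrite -big_mkcond/=.
  by rewrite (big_nat_widenl (K i) 0)//= lexx.
move=> x [i _ Aix]; apply: often_imp (lA i x Aix) => k.
instantiate (1 := maxn i (K i)); rewrite geq_max => /andP[ik Kk].
by apply: balls_sub => c cl; apply: (mem_diagonal ik); rewrite /l' Kk.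
Qed.

Lemma cov_bigcup (T : countType) b s (A : T -> set 'rV[R]_n) :
  (forall i, cov b s (A i)) -> cov b s (\bigcup_i A i).
Proof.
move=> As; pose A' k := if unpickle k is Some i then A i else set0.
apply: (@sub_cov _ _ _ (\bigcup_k A' k)).
  by move=> x [i _ Aix]; exists (pickle i) => //; rewrite /A' pickleK.
by apply: cov_bigcup_nat => k; rewrite /A'; case: unpickle => // *; exact: cov0.
Qed.

End Cov.

(** * Slices and joins *)

Section Slice.
Context {R : realType} {n : nat}.
Implicit Types (E : set 'rV[R]_n) (s t : R) (b : bool).
Let mu := @lebesgue_measure R.

Definition slice E (i : 'I_n) (a : R) : set 'rV[R]_n :=
  E `&` [set x | x ord0 i = a].

(** Otherwise the null exceptional set would contain an interval of positive length. *)
Lemma ae_itvoo (P : R -> Prop) (u v : R) :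
  (\forall a \ae mu, P a) -> u < v -> exists a, [/\ P a, u < a & a < v].
Proof.
move=> [N [mN N0 PN]] uv; apply: contrapT => noP.
have : (mu `]u, v[%classic <= mu N)%E.
  apply: le_measure; rewrite ?inE//.
  move=> a /=; rewrite in_itv/= => /andP[ua av]; apply: (PN a) => /= Pa.
  by apply: noP; exists a.
rewrite N0 /mu lebesgue_measure_itv/= lte_fin uv -EFinB lee_fin leNgt.
by rewrite subr_gt0 uv.
Qed.

(** A ball of radius 2^-k meets the hyperplane x_i = a only for [a] in an interval of length 2 *
    2^-k. Hence its (s - 1)-weight, integrated over those [a], is twice its s-weight. The total over
    all balls has finite integral and is therefore finite for almost every [a]. *)
Lemma ae_cov_slice b s E (i : 'I_n) :
  cov b s E -> \forall a \ae mu, cov b (s - 1) (slice E i a).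
Proof.
move=> [l [[C lC] El]].
pose I (k : nat) (c : 'rV[R]_n) : set R :=
  `[c ord0 i - 2^-1 ^+ k, c ord0 i + 2^-1 ^+ k]%classic.
pose f k (c : 'rV[R]_n) (a : measurableTypeR R) : \bar R :=
  (scale (s - 1) ^+ k * \1_(I k c) a)%:E.
pose F k (a : measurableTypeR R) : \bar R := (\sum_(c <- l k) f k c a)%E.
have f0 k c a : (0 <= f k c a)%E by rewrite lee_fin mulr_ge0// scaleX_ge0.
have mI k c : measurable (I k c : set (measurableTypeR R)).
  exact: measurable_itv.
have mf k c : measurable_fun [set: measurableTypeR R] (f k c).
  by apply/measurable_EFinP/measurable_funM => //; exact/measurable_indic/mI.
have F0 k a : (0 <= F k a)%E by apply: sume_ge0.
have mF k : measurable_fun [set: measurableTypeR R] (F k).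
  by apply: emeasurable_sum => c; exact: mf.
have muI k c : mu (I k c) = (2 * 2^-1 ^+ k)%:E.
  have r0 : 0 < 2^-1 ^+ k :> R by rewrite exprn_gt0.
  rewrite /mu /I lebesgue_measure_itv/= lte_fin ltrD2l gtrN// -EFinB.
  by congr (_%:E); ring.
have intf k c : (\int[mu]_a f k c a = (2 * scale s ^+ k)%:E)%E.
  rewrite [LHS](integralZl_indic (m := mu) measurableT (fun=> I k c))//.
  2: by move=> h; have := scaleX_ge0 (s - 1) k; rewrite leNgt h.
  rewrite integral_indic// setIT [X in (_ * X)%E](muI k c) -EFinM; congr (_%:E).
  rewrite [X in _ = 2 * scale X ^+ k](_ : s = s - 1 + 1); last by ring.
  by rewrite [scale (s - 1 + 1)]scaleD scale1 exprMn; ring.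
have intF k : (\int[mu]_a F k a = (2 * weight s l k)%:E)%E.
  rewrite ge0_integral_sum//.
  rewrite (eq_bigr (fun=> (2 * scale s ^+ k)%:E)) => [|c _]; last exact: intf.
  rewrite sumEFin big_const_seq count_predT iter_addr_0 /weight.
  by congr (_%:E); rewrite -mulr_natl; ring.
pose G (a : measurableTypeR R) : \bar R := (\sum_(0 <= k <oo) F k a)%E.
have mG : measurable_fun [set: measurableTypeR R] G.
  exact: ge0_emeasurable_sum.
have intG : mu.-integrable setT G.
  apply/integrableP; split => //.
  rewrite (eq_integral G); last first.
    by move=> a _; rewrite gee0_abs// nneseries_ge0.
  rewrite integral_nneseries//.
  apply: (@le_lt_trans _ _ (2 * C)%:E); last exact: ltry.
  apply: lime_le.
    by apply: is_cvg_nneseries => k _ _; exact: integral_ge0.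
  apply: nearW => N.
  rewrite (eq_bigr (fun k => (2 * weight s l k)%:E)) => [|k _].
    2: exact: intF.
  by rewrite sumEFin lee_fin -mulr_sumr ler_wpM2l.
apply: filterS (integrable_ae measurableT intG) => a /(_ Logic.I) Gfin.
(* For such an [a], keep the balls whose center is close enough to the hyperplane; their weight at
   scale [k] is exactly [F k a]. *)
exists (fun k => [seq c : 'rV[R]_n <- l k | `|c ord0 i - a| <= 2^-1 ^+ k]).
split.
  exists (fine (\sum_(0 <= k <oo) F k a)%E) => N.
  rewrite -lee_fin fineK// -sumEFin.
  apply: le_trans (nneseries_lim_ge N (fun k _ _ => F0 k a)).
  apply: lee_sum => k _; rewrite /F /f sumEFin lee_fin -mulr_sumr /weight.
  rewrite [leLHS]mulrC ler_wpM2l//; first exact: scaleX_ge0.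
  rewrite size_filter -sum1_count natr_sum big_mkcond/=; apply: ler_sum => c _.
  by rewrite indicE mem_setE in_itv/= -ler_distl distrC; case: ifP.
move=> x [Ex /= xa]; apply: (@often_imp _ 0) (El _ Ex) => k _ [c cl xc].
exists c => //; rewrite mem_filter cl andbT.
rewrite distrC -xa; have := coord_le_enorm (x - c) i.
by rewrite !mxE => /le_trans; apply.
Qed.


(** The bound [M] on the parameter and on the distance gives a uniform Lipschitz constant; whole
    lines are recovered by letting [M] range over the naturals. *)
Definition join_image (M : nat) (A B : set 'rV[R]_n) : set 'rV[R]_n :=
  [set z | exists x y t, [/\ A x, B y, `|t| <= M%:R, enorm (y - x) <= M%:R &
                             z = x + t *: (y - x)]].

(** Discretizes the line parameter at scale 2^-k; the growth of the grid like 2^k accounts for the +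
    1 in the exponent of a join. *)
Lemma interval_grid (M k : nat) : exists g : seq R,
  [/\ size g = (2 * M * 2 ^ k).+1, forall u, u \in g -> `|u| <= M%:R &
      forall t, `|t| <= M%:R -> exists2 u, u \in g & `|t - u| <= 2^-1 ^+ k].
Proof.
exists [seq i%:R * 2^-1 ^+ k - M%:R | i <- iota 0 (2 * M * 2 ^ k).+1].
have r0 : 0 < 2^-1 ^+ k :> R by rewrite exprn_gt0.
have X2 : 2^-1 ^+ k * 2 ^+ k = 1 :> R by rewrite -exprMn mulVf// expr1n.
split; first by rewrite size_map size_iota.
  move=> u /mapP[i]; rewrite mem_iota add0n ltnS => /andP[_ iM] ->.
  have : i%:R * 2^-1 ^+ k <= 2 * M%:R :> R.
    rewrite (_ : 2 * M%:R = (2 * M * 2 ^ k)%:R * 2^-1 ^+ k).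
      by rewrite ler_pM2r// ler_nat.
    by rewrite !natrM natrX -mulrA [_ * 2^-1 ^+ k]mulrC X2 mulr1.
  have : 0 <= i%:R * 2^-1 ^+ k :> R by rewrite mulr_ge0// ltW.
  by rewrite ler_norml => h1 h2; apply/andP; split; lra.
move=> t; rewrite ler_norml => /andP[Mt tM].
have t0 : 0 <= (t + M%:R) * 2 ^+ k by rewrite mulr_ge0 ?exprn_ge0//; lra.
(* The grid point is obtained by rounding (t + M) 2^k down. *)
have /andP[it ti] := truncn_itv t0; set i := Num.trunc _ in it ti.
exists (i%:R * 2^-1 ^+ k - M%:R).
  apply/mapP; exists i => //; rewrite mem_iota add0n ltnS/= -(ler_nat R).
  apply: (le_trans it); rewrite !natrM natrX ler_wpM2r ?exprn_ge0//; lra.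
have tY : t + M%:R = 2^-1 ^+ k * ((t + M%:R) * 2 ^+ k).
  by rewrite mulrCA X2 mulr1.
move: it; rewrite -(ler_pM2l r0) -tY => it'.
move: (ltW ti); rewrite -(ler_pM2l r0) -tY -natr1 => ti'.
by rewrite ler_norml; apply/andP; split; lra.
Qed.

Lemma enorm_join (x y c c' : 'rV[R]_n) (t u M r : R) :
  `|u| <= M -> enorm (y - x) <= M -> `|t - u| <= r ->
  enorm (x - c) <= r -> enorm (y - c') <= r ->
  enorm (x + t *: (y - x) - (c + u *: (c' - c))) <= (3 * M + 1) * r.
Proof.
move=> uM yxM tu xc yc.
have -> : x + t *: (y - x) - (c + u *: (c' - c)) =
    (x - c) + (u *: (y - c') - u *: (x - c)) + (t - u) *: (y - x).
  by apply/rowP => i; rewrite !mxE; ring.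
apply: (le_trans (enormD _ _)); rewrite enormZ.
apply: (@le_trans _ _ (enorm (x - c) +
  (`|u| * enorm (y - c') + `|u| * enorm (x - c)) + `|t - u| * enorm (y - x))).
  rewrite lerD2r (le_trans (enormD _ _))// lerD2l (le_trans (enormD _ _))//.
  by rewrite enormN !enormZ.
have r0 : 0 <= r by exact: le_trans (enorm_ge0 _) xc.
have -> : (3 * M + 1) * r = r + (M * r + M * r) + r * M by ring.
by rewrite !lerD// ler_pM// enorm_ge0.
Qed.

(** At each scale, combine all pairs of centers with all grid parameters. The weights of [lA] are
    summable, those of [lB] are bounded, and the grid has at most (2M + 1) 2^k points. As [B] is
    covered at all large scales, it is covered at every large scale at which [A] is. *)
Lemma cov_join_image b s t (M : nat) (A B : set 'rV[R]_n) :
  cov b s A -> cov true t B -> cov b (s + t + 1) (join_image M A B).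
Proof.
move=> [lA [[CA lAC] lAP]] [lB [[CB lBC] lBP]].
have {}lBC k : weight t lB k <= CB.
  apply: le_trans (lBC k.+1); rewrite big_nat_recr//= lerDr.
  by apply: sumr_ge0 => i _; exact: weight_ge0.
have /choice[g gP] := interval_grid M.
(* Balls of scale [j + d] serve for scale [j]: the error factor 3M + 1 from [enorm_join] is absorbed
   because 3M + 1 = d < 2^d. *)
pose d := (3 * M + 1)%N; pose sg := s + t + 1.
pose l j := let k := (j + d)%N in
  [seq p.1 + u *: (p.2 - p.1)
  | p <- [seq (c, c') | c <- lA k, c' <- lB k], u <- g k].
exists l; split.
  (* The three factors pay for the shift by [d], the weights of [lB] and the grid, in this order. *)
  pose D := (scale sg ^+ d)^-1 * CB * (2 * M + 1)%:R.
  have D0 : 0 <= D.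
    rewrite !mulr_ge0// ?invr_ge0 ?scaleX_ge0//.
    exact: le_trans (weight_ge0 _ _ 0) (lBC 0).
  exists (D * CA) => N.
  apply: (@le_trans _ _ (D * \sum_(0 <= k < N + d) weight s lA k)); last first.
    by rewrite ler_wpM2l.
  rewrite addnC (big_cat_nat (leq0n d) (leq_addr N d))/= -{2}[d]add0n.
  rewrite big_addn addKn.
  apply: (@le_trans _ _ (D * \sum_(0 <= j < N) weight s lA (j + d)));
    last by rewrite ler_wpM2l// lerDr sumr_ge0// => i _; exact: weight_ge0.
  rewrite mulr_sumr; apply: ler_sum => j _.
  rewrite /weight /l !size_allpairs; have [-> _ _] := gP (j + d)%N.
  set k := (j + d)%N.
  have -> : scale sg ^+ j = (scale sg ^+ d)^-1 * scale sg ^+ k.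
    by rewrite /k exprD mulrC mulfK// expf_neq0// gt_eqF// scale_gt0.
  have -> : scale sg ^+ k = scale s ^+ k * scale t ^+ k * 2^-1 ^+ k.
    by rewrite /sg !scaleD scale1 !exprMn.
  rewrite !natrM.
  have -> : forall a b1 c1 d1 e1 f1 h1 : R,
    a * b1 * c1 * (d1 * (e1 * f1 * h1)) =
    d1 * (b1 * f1) * (c1 * h1) * (a * e1) by move=> *; ring.
  rewrite ler_wpM2r//; first exact: (weight_ge0 s lA k).
  rewrite ler_pM//.
  - by rewrite !mulr_ge0// ?invr_ge0 ?scaleX_ge0.
  - by rewrite ler_wpM2l ?invr_ge0 ?scaleX_ge0//; exact: lBC.
  rewrite -natr1 mulrDl mul1r natrM natrX -mulrA -exprMn mulfV// expr1n mulr1.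
  by rewrite natrD lerD2l exprn_ile1// invf_le1 ?ler1n.
move=> z [x [y [u [Ax By uM yxM ->]]]].
have := often_shift d (often_and (lAP _ Ax) (lBP _ By)).
apply: (@often_imp _ 0) => j _ [[c cl xc] [c' cl' yc]].
have [_ gM /(_ _ uM)[v vg uv]] := gP (j + d)%N.
exists (c + v *: (c' - c)).
  by apply/allpairsP; exists ((c, c'), v); split=> //; apply: allpairs_f.
apply: (le_trans (enorm_join (gM _ vg) yxM uv xc yc)).
rewrite exprD mulrCA ler_piMr ?exprn_ge0//.
have -> : 3 * M%:R + 1 = d%:R :> R by rewrite natrD natrM.
rewrite exprVn ler_pdivrMr ?exprn_gt0// mul1r -natrX ler_nat ltnW//.
exact: ltn_expl.
Qed.

End Slice.

(** * Covering the lineal extension by joins of slices *)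

Section Lineal.
Context {R : realType} {n : nat}.
Implicit Types (E : set 'rV[R]_n) (s t : R) (b : bool).
Let mu := @lebesgue_measure R.

Lemma segment_meets_slice (p q : 'rV[R]_n) (i : 'I_n) (E : set 'rV[R]_n) a :
  [set (1 - t) *: p + t *: q | t in `[0, 1]] `<=` E ->
  Num.min (p ord0 i) (q ord0 i) < a < Num.max (p ord0 i) (q ord0 i) ->
  exists t : R, slice E i a ((1 - t) *: p + t *: q).
Proof.
move=> SE /andP[ma aM].
have pq : p ord0 i != q ord0 i.
  by apply: contraTneq (lt_trans ma aM) => ->; rewrite minxx maxxx ltxx.
have d0 : q ord0 i - p ord0 i != 0 by rewrite subr_eq0 eq_sym.
(* The parameter at which the [i]-th coordinate, affine along the segment, equals [a]. *)
exists ((a - p ord0 i) / (q ord0 i - p ord0 i)); split; last first.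
  by rewrite /= !mxE; field.
apply: SE; exists ((a - p ord0 i) / (q ord0 i - p ord0 i)) => //=.
rewrite in_itv/=; case: (ltgtP (p ord0 i) (q ord0 i)) pq => // pq _.
  have qp : 0 < q ord0 i - p ord0 i by rewrite subr_gt0.
  move: ma aM; rewrite (min_idPl (ltW pq)) (max_idPr (ltW pq)) => ma aM.
  apply/andP; split; first by rewrite divr_ge0// ltW// subr_gt0.
  by rewrite ler_pdivrMr// mul1r lerB// ltW.
have qp : 0 < p ord0 i - q ord0 i by rewrite subr_gt0.
move: ma aM; rewrite (min_idPr (ltW pq)) (max_idPl (ltW pq)) => ma aM.
rewrite -[q ord0 i - _]opprB -[a - _]opprB invrN mulrNN.
apply/andP; split; first by rewrite divr_ge0// ltW// subr_gt0.
by rewrite ler_pdivrMr// mul1r lerB// ltW.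
Qed.

Lemma cov_lineal_extension b s t E : cov b s E -> cov true t E ->
  cov b (s + t - 1) (lineal_extension E).
Proof.
move=> Es Et.
pose good i a := cov b (s - 1) (slice E i a) /\ cov true (t - 1) (slice E i a).
have ae_good i : \forall a \ae mu, good i a.
  exact: (@filterI _ _ (ae_filter_ringOfSetsType lebesgue_measure) _ _
    (ae_cov_slice i Es) (ae_cov_slice i Et)).
(* Fix one good height in each rational interval, for each coordinate. An empty interval also
   receives a good height, so that every member of the countable union below is covered. *)
have /choice[h hP] : forall x : 'I_n * rat * rat, exists a : R,
    good x.1.1 a /\ (x.1.2 < x.2 -> ratr x.1.2 < a < ratr x.2).
  move=> [[i p] q] /=; have [pq|_] := ltP p q.
    have [|a [ga pa aq]] := @ae_itvoo R (good i) (ratr p) (ratr q) (ae_good i).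
      by rewrite ltr_rat.
    by exists a; rewrite pa.
  by have [a [ga _ _]] := ae_itvoo (ae_good i) ltr01; exists a.
pose T : countType := ('I_n * (rat * rat) * (rat * rat) * nat)%type.
pose A (x : T) := let: (i, (p, q), (p', q'), M) := x in
  join_image M (slice E i (h (i, p, q))) (slice E i (h (i, p', q'))).
apply: (@sub_cov _ _ _ _ _ (\bigcup_x A x)); last first.
  apply: cov_bigcup => -[[[i [p q]] [p' q']] M] /=.
  have -> : s + t - 1 = (s - 1) + (t - 1) + 1 by ring.
  by apply: cov_join_image; [exact: (hP (i, p, q)).1.1|
                             exact: (hP (i, p', q')).1.2].
move=> z [L [[w0 [v [v0 ->]]] [S [[p [q [pq ->]]] Ssub]]] [tz _ <-]].
have /existsP[i piq] : [exists i, p ord0 i != q ord0 i].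
  rewrite -negb_forall; apply/negP => /forallP pqE; apply: pq.
  by apply/rowP => i; apply/eqP.
pose m0 := Num.min (p ord0 i) (q ord0 i).
pose m1 := Num.max (p ord0 i) (q ord0 i).
have m01 : m0 < m1.
  by rewrite /m0 /m1; case: (ltgtP (p ord0 i) (q ord0 i)) piq.
(* Choosing one height on each side of the midpoint makes the two heights distinct, so the two
   points found on the segment differ and span the line. *)
have [md1 md2] := midf_lt m01; set md := (m0 + m1) / 2 in md1 md2.
have pick u u' : u < u' -> exists x : rat * rat,
    u < h (i, x.1, x.2) < u'.
  move=> uu'; have [r1] := rat_in_itvoo uu'; rewrite in_itv/= => /andP[ur1 r1u].
  have [r2] := rat_in_itvoo r1u; rewrite in_itv/= => /andP[r12 r2u].
  exists (r1, r2) => /=; have [_ /=] := hP (i, r1, r2).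
  rewrite -(ltr_rat R) r12 => /(_ isT)/andP[h1 h2].
  by rewrite (lt_trans ur1 h1) (lt_trans h2 r2u).
have [x1 /andP[h1 h1']] := pick _ _ md1.
have [x2 /andP[h2 h2']] := pick _ _ md2.
set a1 := h _ in h1 h1'; set a2 := h _ in h2 h2'.
have SE : [set (1 - t0) *: p + t0 *: q | t0 in `[0, 1]] `<=` E.
  by move=> y /Ssub[].
have [t1] : exists t0 : R, slice E i a1 ((1 - t0) *: p + t0 *: q).
  by apply: segment_meets_slice SE _; rewrite h1 (lt_trans h1').
set X := _ + _ => XE.
have [t2] : exists t0 : R, slice E i a2 ((1 - t0) *: p + t0 *: q).
  by apply: segment_meets_slice SE _; rewrite h2' andbT (lt_trans _ h2).
set Y := _ + _ => YE.
have onL (t0 : R) : exists u, (1 - t0) *: p + t0 *: q = w0 + u *: v.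
  have [|_ [up _ upE]] := Ssub p.
    exists 0; first by rewrite /= in_itv/= lexx ler01.
    by rewrite subr0 scale1r scale0r addr0.
  have [|_ [uq _ uqE]] := Ssub q.
    exists 1; first by rewrite /= in_itv/= lexx ler01.
    by rewrite subrr scale1r scale0r add0r.
  exists ((1 - t0) * up + t0 * uq); rewrite -upE -uqE.
  by apply/rowP => j; rewrite !mxE; ring.
have [u1 Xu1] := onL t1; have [u2 Yu2] := onL t2.
have u12 : u2 - u1 != 0.
  rewrite subr_eq0; apply/eqP => u21.
  have : X = Y by rewrite /X /Y Xu1 Yu2 u21.
  move: XE YE => [_ /= Xa] [_ /= Ya] XY; move: (lt_trans h1' h2).
  by rewrite -Xa -Ya XY ltxx.
(* With [u1], [u2] and [tz] the parameters of [X], [Y] and [z] on the line, this [w] solves z = X +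
   w (Y - X). *)
pose w := (tz - u1) / (u2 - u1).
pose M := maxn (Num.trunc `|w|).+1 (Num.trunc (enorm (Y - X))).+1.
exists (i, (x1.1, x1.2), (x2.1, x2.2), M) => //=.
exists X, Y, w; split => //.
- rewrite (le_trans (ltW (proj2 (andP (truncn_itv (normr_ge0 _))))))//.
  by rewrite ler_nat leq_maxl.
- rewrite (le_trans (ltW (proj2 (andP (truncn_itv (enorm_ge0 _))))))//.
  by rewrite ler_nat leq_maxr.
rewrite /X /Y Xu1 Yu2 /w; apply/rowP => j; rewrite !mxE.
by field.
Qed.

End Lineal.

(** * Covers versus Hausdorff and packing measures *)

Section Convert.
Context {R : realType} {n : nat}.
Implicit Types (E : set 'rV[R]_n) (s t : R) (b : bool).

(** Group the terms by scale: by injectivity at most [size (l k)] of them have scale [k], so the sum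
    is bounded by a tail of the weights. *)
Lemma sum_scale_le (T W : eqType) s (l : nat -> seq W) (F : seq T)
    (kap : T -> nat) (c : T -> W) (K : nat) (e : R) :
  uniq F ->
  {in F &, forall p q, kap p = kap q -> c p = c q -> p = q} ->
  {in F, forall p, (K <= kap p)%N /\ c p \in l (kap p)} ->
  (forall N, \sum_(K <= k < N) weight s l k <= e) ->
  \sum_(p <- F) scale s ^+ kap p <= e.
Proof.
move=> uF injF FK le.
pose N := (\max_(p <- F) kap p).+1.
apply: le_trans (le N).
apply: (@le_trans _ _ (\sum_(p <- F) \sum_(K <= k < N)
    (if k == kap p then scale s ^+ k else 0))).
  rewrite big_seq [leRHS]big_seq; apply: ler_sum => p pF.
  rewrite -big_mkcond big_nat1_eq (FK p pF).1 ltnS.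
  by rewrite (big_rem p)//= leq_maxl.
rewrite exchange_big/=; apply: ler_sum => k _.
rewrite -big_mkcond/= /weight big_const_seq iter_addr_0 -[leLHS]mulr_natl.
rewrite ler_wpM2r ?scaleX_ge0// ler_nat -size_filter -(size_map c).
apply: uniq_leq_size.
  rewrite map_inj_in_uniq ?filter_uniq// => p q.
  rewrite !mem_filter => /andP[/eqP kp pF] /andP[/eqP kq qF].
  by apply: injF => //; rewrite -kp -kq.
move=> x /mapP[p]; rewrite mem_filter => /andP[/eqP -> pF] ->.
exact: (FK p pF).2.
Qed.

Lemma half_expr_le (e : R) : 0 < e ->
  exists K, forall k, (K <= k)%N -> 2^-1 ^+ k <= e.
Proof.
move=> e0; have : `|2^-1 : R| < 1 by rewrite ger0_norm// invf_lt1 ?ltr1n.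
move=> /cvg_expr/cvgrPdist_le/(_ _ e0)[K _ KP]; exists K => k /KP/=.
by rewrite sub0r normrN ger0_norm.
Qed.

Lemma dyadic_scale (q : nat) (d : R) : 0 < d -> d <= 2^-1 ^+ q ->
  exists k, [/\ (q <= k)%N, 2^-1 ^+ k.+1 < d & d <= 2^-1 ^+ k].
Proof.
move=> d0 dq; have exk : exists k, 2^-1 ^+ k < d.
  (* Halving [d] turns the bound of [half_expr_le] into a strict one; [k.+1] will be the least
     exponent with 2^-(k+1) < d. *)
  have d2 : 0 < d / 2 by rewrite divr_gt0.
  have [K KP] := half_expr_le d2.
  by exists K; rewrite (le_lt_trans (KP K (leqnn K)))//; lra.
have [k kd kmin] := ex_minnP exk.
have k0 : (q < k)%N.
  rewrite ltnNge; apply/negP => kq; have := lt_le_trans kd dq.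
  by rewrite ltNge ler_wiXn2l// invf_le1 ?ler1n.
case: k => // k in kd kmin k0 *.
exists k; split => //.
by rewrite leNgt; apply/negP => /kmin; rewrite ltnn.
Qed.

(* A vanishing diameter is replaced by a radius of negligible weight. *)
Lemma dyadic_radius s (q : nat) (d eta : R) : 0 <= s -> 0 <= d ->
  d <= 2^-1 ^+ q -> 0 < eta -> exists k : nat,
  [/\ (q <= k)%N, d <= 2^-1 ^+ k & scale s ^+ k <= 2 `^ s * d `^ s + eta].
Proof.
move=> s0 d0 dq eta0.
have [->|dN0] := eqVneq d 0.
  have [->|sN0] := eqVneq s 0.
    exists q; split; rewrite ?exprn_ge0//.
    by rewrite scale0 expr1n !powRr0 mulr1 lerDl ltW.
  have sp : 0 < s by rewrite lt_def sN0.
  have := cvg_expr (z := scale s); rewrite ger0_norm ?ltW ?scale_gt0//.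
  move=> /(_ (scale_lt1 sp))/cvgrPdist_le/(_ _ eta0)[K _ KP].
  exists (maxn q K); split; [exact: leq_maxl|exact: exprn_ge0|].
  rewrite powR0// mulr0 add0r; have := KP (maxn q K) (leq_maxr _ _).
  by rewrite /= sub0r normrN ger0_norm// scaleX_ge0.
have dp : 0 < d by rewrite lt_def dN0.
have [k [qk kd dk]] := dyadic_scale dp dq; exists k; split => //.
rewrite -powR_half -powRM//; apply: ler_wpDr; first exact: ltW.
apply: ge0_ler_powR => //; rewrite ?nnegrE ?exprn_ge0 ?mulr_ge0//.
by move: kd; rewrite exprS => kd; lra.
Qed.

(** All indices of one scale contribute the same positive amount to a bounded sum, so each scale
    occurs finitely often and the sequence can be sorted into finite lists. *)
Lemma group_scales s (Q : pred nat) (kap : nat -> nat) (c : nat -> 'rV[R]_n)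
    (C : R) :
  (forall J, \sum_(0 <= j < J | Q j) scale s ^+ kap j <= C) ->
  exists l : nat -> seq 'rV[R]_n,
    (forall N, \sum_(0 <= k < N) weight s l k <= C) /\
    forall j, Q j -> c j \in l (kap j).
Proof.
move=> QC.
pose u k j := if Q j && (kap j == k) then scale s ^+ k else 0.
have u0 k j : 0 <= u k j by rewrite /u; case: ifP => // _; exact: scaleX_ge0.
have uC k J : \sum_(0 <= j < J) u k j <= C.
  apply: le_trans (QC J); rewrite [leRHS]big_mkcond; apply: ler_sum => j _.
  rewrite /u; case: (Q j) => //=; case: eqP => [->//|_]; exact: scaleX_ge0.
have /choice[J JP] : forall k, exists J, forall j, Q j -> kap j = k ->
    (j < J)%N.
  move=> k; have wk : 0 < scale s ^+ k / 2.
    by rewrite divr_gt0 ?exprn_gt0 ?scale_gt0.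
  (* Beyond [J] the tail is at most half of a single term of scale [k], so no such term is left. *)
  have [J JP] := bounded_series_tail (u0 k) (uC k) wk.
  exists J => j Qj jk; rewrite ltnNge; apply/negP => Jj.
  have := JP J j.+1 (leqnn J); rewrite big_nat_recr//= {2}/u Qj jk eqxx/=.
  apply/negP; rewrite -ltNge ltr_wpDl ?sumr_ge0//.
  by rewrite ltr_pdivrMr// ltr_pMr ?ltr1n// exprn_gt0// scale_gt0.
exists (fun k => [seq c j | j <- iota 0 (J k) & Q j && (kap j == k)]); split.
  move=> N; pose M := (\max_(k < N) J k)%N.
  apply: le_trans (QC M).
  apply: (@le_trans _ _ (\sum_(0 <= k < N) \sum_(0 <= j < M) u k j)).
    rewrite !big_mkord; apply: ler_sum => k _.
    apply: (@le_trans _ _ (\sum_(0 <= j < J k) u k j)).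
      rewrite /weight size_map size_filter /u -big_mkcond/= big_const_seq.
      by rewrite iter_addr_0 mulr_natl /index_iota subn0.
    apply: ler_sum_nat_sub => //; exact: leq_bigmax.
  rewrite exchange_big_nat/= [leRHS]big_mkcond; apply: ler_sum => j _.
  rewrite /u; case: (Q j) => /=; last by rewrite big1.
  rewrite -big_mkcond/=; under eq_bigl do rewrite eq_sym.
  by rewrite big_nat1_eq; case: ifP => // _; exact: scaleX_ge0.
move=> j Qj; apply/mapP; exists j => //.
by rewrite mem_filter Qj eqxx mem_iota/= add0n; exact: JP.
Qed.

Lemma enorm_le_diam (U : set 'rV[R]_n) x y :
  U x -> U y -> ((enorm (x - y))%:E <= diam U)%E.
Proof. by move=> Ux Uy; apply: ereal_sup_ubound; exists x => //; exists y. Qed.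

(** For each [q], take a cover by sets of diameter at most 2^-q and total s-weight below 2^-q, and
    enclose each piece in a dyadic ball. Since the [q]-th cover uses only scales [k >= q], merging
    the covers diagonally covers each point at infinitely many scales. *)
Lemma cov_of_hausdorff_measure0 s E : 0 <= s -> hausdorff_measure s E = 0%E ->
  cov false s E.
Proof.
move=> s0 Es0.
have /choice[l /all_and2[lC lE]] : forall q, exists l : nat -> seq 'rV[R]_n,
    (* The 2^s comes from rounding diameters up to powers of 1/2, the 2 from summing the corrections
       2^-q 2^-j over [j]. *)
    (forall N, \sum_(0 <= k < N) weight s l k <= (2 `^ s + 2) * 2^-1 ^+ q) /\
    forall x, E x -> exists2 k, (q <= k)%N & balls (l k) (2^-1 ^+ k) x.
  move=> q; have r0 : 0 < 2^-1 ^+ q :> R by rewrite exprn_gt0.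
  have : (hausdorff_delta s (2^-1 ^+ q) E < (2^-1 ^+ q)%:E)%E.
    apply: (@le_lt_trans _ _ 0%E); last by rewrite lte_fin.
    by rewrite -Es0; apply: ereal_sup_ubound; exists (2^-1 ^+ q).
  move=> /ereal_inf_lt[_ [U [EU Uq] <-] Usum].
  have /choice[kc kcP] : forall j, exists kc : nat * 'rV[R]_n, U j !=set0 ->
      [/\ (q <= kc.1)%N, U j `<=` [set x | enorm (x - kc.2) <= 2^-1 ^+ kc.1] &
      ((scale s ^+ kc.1)%:E <= (2 `^ s)%:E * poweR (diam (U j)) s +
         (2^-1 ^+ q * 2^-1 ^+ j)%:E)%E].
    move=> j; have [[c Uc]|U0] := pselect (U j !=set0); last first.
      by exists (0%N, 0) => /U0.
    have Ud : (0%:E <= diam (U j))%E.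
      by have := enorm_le_diam Uc Uc; rewrite subrr enorm0.
    have : diam (U j) \is a fin_num.
      by rewrite ge0_fin_numE// (le_lt_trans (Uq j))// ltry.
    move=> /fineK; set d := fine _ => dE.
    have [|||k [qk dk kd]] :=
      @dyadic_radius s q d (2^-1 ^+ q * 2^-1 ^+ j) s0.
    - by rewrite -lee_fin dE.
    - by rewrite -lee_fin dE Uq.
    - by rewrite mulr_gt0// exprn_gt0.
    exists (k, c) => _; split => //=.
      move=> x Ux /=; apply: le_trans dk; rewrite -lee_fin dE.
      exact: enorm_le_diam.
    by rewrite -dE poweR_EFin -EFinM -EFinD lee_fin.
  have [|l [lC lE]] := @group_scales s (fun j => U j != set0)
      (fun j => (kc j).1) (fun j => (kc j).2) ((2 `^ s + 2) * 2^-1 ^+ q).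
    move=> J; rewrite -lee_fin -sumEFin.
    apply: (@le_trans _ _ (\sum_(0 <= j < J | U j != set0)
      ((2 `^ s)%:E * poweR (diam (U j)) s + (2^-1 ^+ q * 2^-1 ^+ j)%:E))%E).
      apply: lee_sum => j /set0P Uj; by case: (kcP j Uj).
    rewrite big_split/= mulrDl EFinD; apply: leeD.
      rewrite -ge0_sume_distrr => [|j _]; last exact: poweR_ge0.
      rewrite EFinM lee_wpmul2l ?lee_fin ?powR_ge0//.
      apply: le_trans (ltW Usum); apply: nneseries_lim_ge => j _ _.
      exact: poweR_ge0.
    rewrite sumEFin lee_fin mulrC; apply: (@le_trans _ _
      (\sum_(0 <= j < J) 2^-1 ^+ q * 2^-1 ^+ j)).
      rewrite [leLHS]big_mkcond/=; apply: ler_sum => j _.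
      by case: ifP => // _; rewrite mulr_ge0 ?exprn_ge0.
    by rewrite -mulr_sumr ler_wpM2l ?sum_half// ltW.
  exists l; split => // x /EU[j _ Ujx]; have Uj : U j !=set0 by exists x.
  have [qk Uk _] := kcP j Uj; exists (kc j).1 => //.
  by exists (kc j).2; [exact/lE/set0P|exact: Uk].
exists (diagonal l); split.
  exists ((2 `^ s + 2) * 2).
  by apply: weight_diagonal; rewrite ?addr_ge0 ?powR_ge0.
move=> x Ex K; have [k Kk xk] := lE K x Ex; exists k => //.
exact: balls_sub (mem_diagonal Kk) _ xk.
Qed.

End Convert.

(** * From dyadic covers to null Hausdorff measure *)

Section Back.
Context {R : realType} {n : nat}.
Implicit Types (E A : set 'rV[R]_n) (s t : R) (b : bool).

Lemma hausdorff_delta_ge0 s d E : (0 <= hausdorff_delta s d E)%E.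
Proof.
apply/ereal_infP => _ [U _ <-]; apply: nneseries_ge0 => *; exact: poweR_ge0.
Qed.

(** The balls of all scales from [K] on cover [E], have small diameter, and their total weight is a
    tail of a convergent series. *)
Lemma hausdorff_measure0_of_cov s E : 0 <= s -> cov false s E ->
  hausdorff_measure s E = 0%E.
Proof.
move=> s0 [l [[C lC] El]]; apply/eqP; rewrite eq_le.
apply/andP; split; last first.
  apply: (le_trans (hausdorff_delta_ge0 s 1 E)).
  by apply: ereal_sup_ubound; exists 1 => //=.
apply/ereal_supP => _ [d /= d0 <-]; apply/lee_addgt0Pr => e e0; rewrite add0e.
have e0' : 0 < e / 2 `^ s by rewrite divr_gt0// powR_gt0.
have [K1 K1P] := bounded_series_tail (weight_ge0 s l) lC e0'.
have d2 : 0 < d / 2 by rewrite divr_gt0.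
have [K2 K2P] := half_expr_le d2.
pose K := maxn K1 K2.
pose kap i := if @pickle_inv (nat * nat)%type i is Some x then x.1 else 0%N.
pose c i := if @pickle_inv (nat * nat)%type i is Some x then x.2 else 0%N.
pose ctr i : 'rV[R]_n := nth 0 (l (kap i)) (c i).
(* The index [i] codes a scale and a position in its list. The first condition empties the pieces
   whose index codes no pair, where [kap] and [c] take the default 0, so no ball is counted
   twice. *)
pose U i : set 'rV[R]_n := [set x | [/\ pickle (kap i, c i) = i, (K <= kap i)%N,
  (c i < size (l (kap i)))%N & enorm (x - ctr i) <= 2^-1 ^+ kap i]].
have Ud i x y : U i x -> U i y -> enorm (x - y) <= 2 * 2^-1 ^+ kap i.
  move=> [_ _ _ xc] [_ _ _ yc].
  rewrite (le_trans (enorm_triangle _ (ctr i) _))//.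
  by rewrite [enorm (_ - y)]enormC mulrDl mul1r lerD.
apply: (@le_trans _ _ (\sum_(0 <= i <oo | U i != set0)
    (poweR (diam (U i)) s))%E).
  apply: ereal_inf_lbound; exists U => //; split.
    move=> x Ex; have [k Kk [y yl xy]] := El x Ex K.
    exists (pickle (k, index y (l k))) => //.
    rewrite /U /ctr /kap /c pickleK_inv/=; split => //.
      by rewrite index_mem.
    by rewrite nth_index.
  move=> i; apply/ereal_supP => _ [x Ux [y Uy <-]]; rewrite lee_fin.
  have [_ Kk _ _] := Ux; apply: (le_trans (Ud _ _ _ Ux Uy)).
  have := K2P (kap i) (leq_trans (leq_maxr _ _) Kk); lra.
apply: lime_le.
  by apply: is_cvg_nneseries => i _ _; exact: poweR_ge0.
apply: nearW => N.
apply: (@le_trans _ _ (\sum_(0 <= i < N | U i != set0)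
    (2 `^ s * scale s ^+ kap i)%:E)%E).
  apply: lee_sum => i /set0P[x Ux].
  have dU : (diam (U i) <= (2 * 2^-1 ^+ kap i)%:E)%E.
    by apply/ereal_supP => _ [y Uy [z Uz <-]]; rewrite lee_fin Ud.
  have d0U : (0%:E <= diam (U i))%E.
    by have := enorm_le_diam Ux Ux; rewrite subrr enorm0.
  have /fineK dE : diam (U i) \is a fin_num.
    by rewrite ge0_fin_numE// (le_lt_trans dU)// ltry.
  rewrite -dE poweR_EFin lee_fin -powR_half -powRM ?exprn_ge0//.
  apply: ge0_ler_powR => //; rewrite ?nnegrE ?mulr_ge0 ?exprn_ge0//.
    by rewrite -lee_fin dE.
  by rewrite -lee_fin dE.
rewrite sumEFin lee_fin -mulr_sumr mulrC -ler_pdivlMr ?powR_gt0//.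
rewrite -big_filter.
apply: (@sum_scale_le R _ _ s (fun k => iota 0 (size (l k))) _ kap c K).
- by rewrite filter_uniq// iota_uniq.
- move=> i j; rewrite !mem_filter => /andP[/set0P[x [ix _ _ _]] _].
  by move=> /andP[/set0P[y [jy _ _ _]] _] kij cij; rewrite -ix -jy kij cij.
- move=> i; rewrite mem_filter => /andP[/set0P[x [_ Kk ck _]] _].
  by rewrite mem_iota.
move=> J; apply: le_trans (K1P K J (leq_maxl _ _)); apply: ler_sum => k _.
by rewrite /weight size_iota.
Qed.

(** * Packing measure and dyadic covers *)

Lemma packing_delta_ge0 s d E : (0 <= packing_delta s d E)%E.
Proof.
apply: ereal_sup_ubound; exists set0; last by rewrite esum_set0.
by split=> //; exact: trivIset_set0.
Qed.

Lemma packing_premeasure_ge0 s E : (0 <= packing_premeasure s E)%E.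
Proof. by apply/ereal_infP => _ [d _ <-]; exact: packing_delta_ge0. Qed.

(** Split [E] into the sets [A K] of points covered at all scales from [K] on. In a packing of
    [A K], assign to each ball a covering ball of comparable smaller radius containing its center;
    disjointness makes this injective, so the packing sum is bounded by a tail of the weights. *)
Lemma packing_measure0_of_cov s E : 0 <= s -> cov true s E ->
  packing_measure s E = 0%E.
Proof.
move=> s0 [l [[C lC] El]]; apply/eqP; rewrite eq_le.
apply/andP; split; last first.
  apply/ereal_infP => _ [A _ <-]; apply: nneseries_ge0 => *.
  exact: packing_premeasure_ge0.
pose A K : set 'rV[R]_n :=
  [set x | forall k, (K <= k)%N -> balls (l k) (2^-1 ^+ k) x].
apply: (@le_trans _ _ (\sum_(0 <= i <oo) packing_premeasure s (A i))%E).
  by apply: ereal_inf_lbound; exists A => // x /El[K KP]; exists K.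
rewrite eseries0// => K _ _; apply/eqP.
rewrite eq_le packing_premeasure_ge0 andbT.
apply/lee_addgt0Pr => e e0; rewrite add0e.
(* A packing ball of radius at most 4 * 2^-k has (2r)^s at most 8^s times the weight at scale
   [k]. *)
have e0' : 0 < e / 8 `^ s by rewrite divr_gt0// powR_gt0.
have [J JP] := bounded_series_tail (weight_ge0 s l) lC e0'.
pose q := maxn J K.
apply: (@le_trans _ _ (packing_delta s (2^-1 ^+ q) (A K))).
  by apply: ereal_inf_lbound; exists (2^-1 ^+ q) => //=; rewrite exprn_gt0.
apply/ereal_supP => _ [P [_ PA Ptriv] <-].
have /choice[kc kcP] : forall p, exists kc : nat * 'rV[R]_n, P p ->
   [/\ (q <= kc.1)%N, kc.2 \in l kc.1, enorm (p.1 - kc.2) <= 2^-1 ^+ kc.1,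
       2 * 2^-1 ^+ kc.1 < p.2 & p.2 <= 4 * 2^-1 ^+ kc.1].
  move=> p; have [Pp|nP] := pselect (P p); last by exists (0%N, 0).
  have [Ap p0 pq] := PA p Pp; have [k [qk kp pk]] := dyadic_scale p0 pq.
  have qk2 : (q <= k.+2)%N by rewrite (leq_trans qk)// leqW.
  have [|c cl pc] := Ap k.+2; first exact: leq_trans (leq_maxr _ _) qk2.
  (* Two scales finer than the packing radius: centers sharing a covering ball are then closer than
     either radius, so their packing balls intersect. *)
  exists (k.+2, c) => _ /=; split => //.
    by rewrite !exprS mulrA mulfV ?mul1r// -exprS.
  by rewrite !exprS; move: pk; set x := _ ^+ _; lra.
apply/ereal_supP => _ [X [finX XP] <-]; rewrite fsbig_finite//=.
set F := finmap.enum_fset _.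
have FP p : p \in F -> P p.
  by move=> pF; apply: XP; apply: set_mem; rewrite -in_fset_set.
apply: (@le_trans _ _ (\sum_(p <- F) (8 `^ s * scale s ^+ (kc p).1)%:E)%E).
  rewrite big_seq [leRHS]big_seq; apply: lee_sum => p /FP Pp.
  have [_ _ _ h h'] := kcP p Pp; have [_ p0 _] := PA p Pp.
  rewrite lee_fin -powR_half -powRM ?exprn_ge0//.
  apply: ge0_ler_powR => //; rewrite ?nnegrE ?mulr_ge0 ?exprn_ge0 ?(ltW p0)//.
  by move: h'; set x := _ ^+ _; lra.
rewrite sumEFin lee_fin -mulr_sumr mulrC -ler_pdivlMr ?powR_gt0//.
apply: (@sum_scale_le R _ _ s l _ (fun p => (kc p).1) (fun p => (kc p).2) q).
- exact: finmap.fset_uniq.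
- move=> p p' /FP Pp /FP Pp' kk cc; apply: (Ptriv p p' Pp Pp').
  have [_ _ pc rp _] := kcP p Pp; have [_ _ pc' rp' _] := kcP p' Pp'.
  rewrite -kk -cc in pc' rp'; exists p'.1; split; rewrite /ecball/=.
    rewrite (le_trans (enorm_triangle _ (kc p).2 _))// (le_trans _ (ltW rp))//.
    by rewrite [enorm ((kc p).2 - _)]enormC mulrDl mul1r lerD.
  by rewrite subrr enorm0 ltW// (le_lt_trans _ rp')// mulr_ge0 ?exprn_ge0.
- by move=> p /FP/kcP[qk cl _ _ _].
by move=> N; apply: JP; exact: leq_maxl.
Qed.

(** Balls of radius 2^-(k+1) about 2^-k-separated points form a packing in which each ball
    contributes [scale s ^+ k], so the size of separated lists is bounded. A separated list that
    cannot be extended is the center list of a cover. *)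
Lemma separated_cover s (d M : R) A (k : nat) :
  (packing_delta s d A <= M%:E)%E -> 2^-1 ^+ k.+1 <= d ->
  exists l : seq 'rV[R]_n,
    (size l)%:R * scale s ^+ k <= M /\ A `<=` balls l (2^-1 ^+ k).
Proof.
move=> AM kd; have r0 : 0 < 2^-1 ^+ k.+1 :> R by rewrite exprn_gt0.
pose sep (l : seq 'rV[R]_n) := [/\ uniq l, {in l, forall c, A c} &
  {in l &, forall c c', c != c' -> 2^-1 ^+ k < enorm (c - c')}].
have sepM l : sep l -> (size l)%:R * scale s ^+ k <= M.
  move=> [ul lA ll]; rewrite -lee_fin; apply: le_trans AM.
  pose X := [seq (c, 2^-1 ^+ k.+1 : R) | c <- l].
  have uX : uniq X by rewrite map_inj_uniq// => c c' [].
  apply: le_ereal_sup_tmp; exists (\esum_(p in [set` X]) ((2 * p.2) `^ s)%:E)%E.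
    exists [set` X] => //; split; first exact/finite_set_countable/finite_seq.
      by move=> _ /mapP[c /lA Ac ->].
    move=> _ _ /mapP[c cl ->] /mapP[c' c'l ->] [z [/= zc zc']].
    have [->//|cc'] := eqVneq c c'.
    have := ll c c' cl c'l cc'; rewrite ltNge => /negP[].
    rewrite (le_trans (enorm_triangle _ z _))// enormC.
    by move: zc zc'; rewrite /ecball/= exprS; lra.
  rewrite esum_fset; first last.
  - by move=> p _; rewrite lee_fin powR_ge0.
  - exact: finite_seq.
  rewrite -fsbig_seq// big_map/= sumEFin lee_fin big_const_seq count_predT.
  by rewrite iter_addr_0 exprS mulrA mulfV// mul1r powR_half mulr_natl.
apply: contrapT => noc.
have [m mM] : exists m : nat, M < m%:R * scale s ^+ k.
  exists (Num.trunc `|M / scale s ^+ k|).+1.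
  rewrite -ltr_pdivrMr ?exprn_gt0 ?scale_gt0//.
  apply: le_lt_trans (ler_norm _) _.
  by have /andP[] := truncn_itv (normr_ge0 (M / scale s ^+ k)).
(* If no separated list covered [A], any could be enlarged by an uncovered point, reaching the
   forbidden size [m]. *)
have [L sL Lm] : exists2 L, sep L & size L = m.
  elim: m {mM} => [|m IH]; first by exists [::].
  have [u su um] := IH.
  have [x Ax xu] : exists2 x, A x & ~ balls u (2^-1 ^+ k) x.
    apply: contrapT => h; apply: noc; exists u; split; first exact: sepM.
    by move=> x Ax; apply: contrapT => xu; apply: h; exists x.
  have far c : c \in u -> 2^-1 ^+ k < enorm (x - c).
    by move=> cu; rewrite ltNge; apply/negP => xc; apply: xu; exists c.
  exists (x :: u); last by rewrite /= um.
  have [uu uA ud] := su; split.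
  - rewrite /= uu andbT; apply/negP => /far; rewrite subrr enorm0 ltNge.
    by rewrite exprn_ge0.
  - by move=> c; rewrite inE => /predU1P[->//|/uA].
  move=> c c'; rewrite !inE => /predU1P[->|cu] /predU1P[->|c'u].
  - by rewrite eqxx.
  - by move=> _; exact: far.
  - by move=> _; rewrite enormC; exact: far.
  - exact: ud.
by have := sepM _ sL; rewrite Lm leNgt mM.
Qed.

(** At scale [k] at most M 2^(ks) balls suffice, so the t-weights are dominated by a geometric
    series of ratio [scale (t - s)]. Scales too coarse for [d] get empty lists. *)
Lemma cov_of_packing_delta s t (d M : R) A : s < t -> 0 < d ->
  (packing_delta s d A <= M%:E)%E -> cov true t A.
Proof.
move=> st d0 AM.
have M0 : 0 <= M by rewrite -lee_fin (le_trans (packing_delta_ge0 s d A)).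
have /choice[l lP] : forall k, exists l : seq 'rV[R]_n,
    (size l)%:R * scale s ^+ k <= M /\
    (2^-1 ^+ k.+1 <= d -> A `<=` balls l (2^-1 ^+ k)).
  move=> k; have [kd|kd] := boolP (2^-1 ^+ k.+1 <= d).
    by have [l [lM Al]] := separated_cover AM kd; exists l.
  by exists [::]; rewrite mul0r.
have ts0 : 0 < t - s by rewrite subr_gt0.
exists l; split.
  exists (M / (1 - scale (t - s))) => N.
  apply: le_trans (geometric_le_lim N M0 (scale_gt0 _) _); last first.
    by rewrite ger0_norm ?scale_lt1// ltW// scale_gt0.
  rewrite /series/=; apply: ler_sum => k _.
  rewrite /weight (_ : t = s + (t - s)); last by ring.
  rewrite scaleD exprMn mulrA (_ : s + (t - s) - s = t - s); last by ring.
  by rewrite ler_wpM2r ?scaleX_ge0//; exact: (lP k).1.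
have [K KP] := half_expr_le d0.
move=> x Ax; exists K => k Kk; apply: (lP k).2 => //.
by apply: KP; rewrite leqW.
Qed.

(** Nullity splits [E] into countably many pieces of finite premeasure, each of which has a finite
    packing bound at some [d]. *)
Lemma cov_of_packing_measure0 s t E : s < t -> packing_measure s E = 0%E ->
  cov true t E.
Proof.
move=> st E0; have : (packing_measure s E < 1)%E by rewrite E0 lte01.
move=> /ereal_inf_lt[_ [A EA <-] A1].
apply: sub_cov EA _; apply: cov_bigcup_nat => i.
have : (packing_premeasure s (A i) < +oo)%E.
  apply: le_lt_trans (ltry 1); apply: le_trans (ltW A1).
  apply: le_trans (nneseries_lim_ge i.+1 _); last first.
    by move=> *; exact: packing_premeasure_ge0.
  rewrite big_nat_recr//= leeDr// sume_ge0// => *.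
  exact: packing_premeasure_ge0.
move=> /ereal_inf_lt[_ [d /= d0 <-] dlt].
apply: (cov_of_packing_delta st d0 (M := fine (packing_delta s d (A i)))).
by rewrite fineK// ge0_fin_numE// packing_delta_ge0.
Qed.

End Back.

(** * Dimensions as infima, and the dimension bounds *)

Lemma ereal_inf_real (R : realType) (Q : R -> Prop) :
  let x := ereal_inf [set s%:E | s in [set s | 0 <= s /\ Q s]] in
  x = +oo%E \/ exists2 h, x = h%:E &
    forall e, 0 < e -> exists s, [/\ 0 <= s, Q s & s < h + e].
Proof.
move=> x; have x0 : (0 <= x)%E.
  by apply/ereal_infP => _ [s [s0 _] <-]; rewrite lee_fin.
have [->|xoo] := eqVneq x +oo%E; first by left.
have xfin : x \is a fin_num by rewrite ge0_fin_numE// ltey.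
right; exists (fine x); first by rewrite fineK.
move=> e e0; have [_ [s [s0 Qs] <-] sx] := lb_ereal_inf_adherent e0 xfin.
by exists s; split => //; rewrite -lte_fin EFinD fineK.
Qed.

Lemma ereal_inf_real_le (R : realType) (Q : R -> Prop) s : 0 <= s -> Q s ->
  (ereal_inf [set s%:E | s in [set s | (0 <= s)%R /\ Q s]] <= s%:E)%E.
Proof. by move=> s0 Qs; apply: ereal_inf_lbound; exists s. Qed.

Lemma lineal_extension_nonempty (R : realType) (n : nat) (E : set 'rV[R]_n) :
  union_of_segments E -> lineal_extension E !=set0.
Proof.
move=> [F [[S FS] Fseg ->]]; have [a [b [ab SE]]] := Fseg S FS.
have lineP t : exists2 u : R, setT u & a + u *: (b - a) = (1 - t) *: a + t *: b.
  by exists t => //; apply/rowP => j; rewrite !mxE; ring.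
exists a; exists [set a + u *: (b - a) | u in setT].
  split.
    by exists a, (b - a); split => // /eqP; rewrite subr_eq0 => /eqP /esym.
  exists S; split; first exact: Fseg.
  move=> x Sx; split; first by exists S.
  by move: Sx; rewrite SE => -[t _ <-]; exact: lineP.
by exists 0 => //; rewrite scale0r addr0.
Qed.

Theorem proposition1p7 (R : realType) (n : nat) (hn : (2 <= n)%N)
    (E : set 'rV[R]_n) (hE : union_of_segments E) :
  (hausdorff_dim (lineal_extension E)
     <= hausdorff_dim E + packing_dim E - 1)%E /\
  (packing_dim (lineal_extension E) <= 2%:E * packing_dim E - 1)%E.
Proof.
have L0 := lineal_extension_nonempty hE.
have [Poo|[p Pp pP]] := ereal_inf_real (fun s => packing_measure s E = 0%E).
  rewrite [packing_dim E]Poo; split.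
    rewrite addey ?leey//; apply/eqP => h.
    have : (0%:E <= hausdorff_dim E)%E.
      by apply/ereal_infP => _ [s [s0 _] <-]; rewrite lee_fin.
    by rewrite h.
  by rewrite gt0_muley ?lte_fin// leey.
have packE e : 0 < e -> exists2 t, cov true t E & t < p + e.
  move=> e0; have [t [_ Et tp]] := pP e e0.
  (* The midpoint leaves room for the strict increase of exponent in passing from null packing
     measure to covers. *)
  have [tt' t'p] := midf_lt tp.
  by exists ((t + (p + e)) / 2) => //; exact: cov_of_packing_measure0 Et.
rewrite [packing_dim E]Pp; split.
  have [Hoo|[h Hh hP]] := ereal_inf_real (fun s => hausdorff_measure s E = 0%E).
    by rewrite [hausdorff_dim E]Hoo leey.
  rewrite [hausdorff_dim E]Hh; apply/lee_addgt0Pr => e e0.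
  have e2 : 0 < e / 2 by rewrite divr_gt0.
  have [s [s0 Es sh]] := hP _ e2; have [t Et tp] := packE _ e2.
  have Ls := cov_lineal_extension (cov_of_hausdorff_measure0 s0 Es) Et.
  (* The dimension is an infimum over nonnegative exponents; [s + t - 1] is one because the lineal
     extension is nonempty. *)
  have st := ltW (cov_nonempty Ls L0).
  apply: (@le_trans _ _ (s + t - 1)%:E).
    apply: (@ereal_inf_real_le _ (fun s => hausdorff_measure s _ = 0%E)) => //.
    exact: hausdorff_measure0_of_cov.
  rewrite [leRHS](_ : _ = (h + p - 1 + e)%:E)// lee_fin; lra.
apply/lee_addgt0Pr => e e0.
have e2 : 0 < e / 2 by rewrite divr_gt0.
have [t Et tp] := packE _ e2; have Lt := cov_lineal_extension Et Et.
have tt := ltW (cov_nonempty Lt L0).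
apply: (@le_trans _ _ (t + t - 1)%:E).
  apply: (@ereal_inf_real_le _ (fun s => packing_measure s _ = 0%E)) => //.
  exact: packing_measure0_of_cov.
rewrite [leRHS](_ : _ = (2 * p - 1 + e)%:E)// lee_fin; lra.
Qed.
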